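(* Let $\epsilon>0$, let $p\ge1$ be an integer, and let $\mathbf{s}=(s_1,\ldots,s_r)$ be a query with $s_k(\mathbf{x})\in[c_{k0},c_{k1}]$ for all data sets $\mathbf{x}$ and all $k=1,\ldots,r$, the bounds being finite. Consider the truncated generalized Gaussian mechanism of order $p$ with scale $b>0$, which given $\mathbf{x}$ releases $\mathbf{s}^*\in[c_{10},c_{11}]\times\cdots\times[c_{r0},c_{r1}]$ drawn from the density $$f(\mathbf{s}^*\mid\mathbf{x})=\prod_{k=1}^r\frac{p\,\exp\{-(|s_k^*-s_k(\mathbf{x})|/b)^p\}}{2b\,\Gamma(p^{-1})\,A(s_k(\mathbf{x}),b,p)},\qquad c_{k0}\le s_k^*\le c_{k1},$$ where $A(\mu,b,p)=\int_{c_{k0}}^{c_{k1}}\frac{p}{2b\,\Gamma(p^{-1})}\exp\{-(|t-\mu|/b)^p\}\,dt$ is the normalizing probability for the $k$-th coordinate. If $$b\ge\left(2\epsilon^{-1}\left(\sum_{k=1}^r\sum_{j=1}^{p-1}\binom{p}{j}|c_{k1}-c_{k0}|^{p-j}\Delta_{1,k}^j+\Delta_p^p\right)\right)^{1/p},$$ then the mechanism satisfies $\epsilon$-differential privacy.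
   Context: $d(\mathbf{x},\mathbf{x}')=1$ is a symmetric neighboring relation on data sets (they differ by one individual). $\Delta_{1,k}=\max_{d(\mathbf{x},\mathbf{x}')=1}|s_k(\mathbf{x})-s_k(\mathbf{x}')|$ is the $l_1$ global sensitivity of $s_k$, and $\Delta_p=\max_{d(\mathbf{x},\mathbf{x}')=1}\left(\sum_{k=1}^r|s_k(\mathbf{x})-s_k(\mathbf{x}')|^p\right)^{1/p}$ is the $l_p$ global sensitivity of $\mathbf{s}$ (maxima understood as suprema). A randomized mechanism $\mathcal{R}$ satisfies $\epsilon$-differential privacy if, for all $\mathbf{x},\mathbf{x}'$ with $d(\mathbf{x},\mathbf{x}')=1$ and all (measurable) sets $Q$ of outputs, $\left|\log\left(\Pr(\mathcal{R}(\mathbf{s}(\mathbf{x}))\in Q)/\Pr(\mathcal{R}(\mathbf{s}(\mathbf{x}'))\in Q)\right)\right|\le\epsilon$ (for $Q$ of positive probability). *)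

(* Defs.v *)
From HB Require Import structures.
From mathcomp Require Import all_boot all_order all_algebra.
From mathcomp Require Import all_classical all_reals all_analysis.

Set Implicit Arguments.
Unset Strict Implicit.
Unset Printing Implicit Defensive.
Import Order.TTheory GRing.Theory Num.Theory.
Import numFieldNormedType.Exports.
Local Open Scope classical_set_scope.
Local Open Scope ring_scope.

(* [mpower mu n] is the n-fold product measure of mu on n.-tuple T, see
   [mpower_box]. For mu the Lebesgue measure, it is the Lebesgue measure on the
   Borel sets of R^n. *)
Section measure_power.
Context d (T : measurableType d) (R : realType).
Variable mu : {sigma_finite_measure set T -> \bar R}.

Section step.
Context (n : nat) (m : {sigma_finite_measure set (n.-tuple T) -> \bar R}).

Definition tuple_consp (xv : T * n.-tuple T) : n.+1.-tuple T :=
  [tuple of xv.1 :: xv.2].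

Definition tuple_unconsp (v : n.+1.-tuple T) : T * n.-tuple T :=
  (thead v, [tuple of behead v]).

Lemma tuple_conspK : cancel tuple_consp tuple_unconsp.
Proof.
by case=> x v; rewrite /tuple_unconsp /= theadE; congr pair; exact: val_inj.
Qed.

Lemma measurable_tuple_consp : measurable_fun setT tuple_consp.
Proof. exact: (measurable_cons measurable_fst measurable_snd). Qed.

Lemma measurable_tuple_unconsp : measurable_fun setT tuple_unconsp.
Proof.
by apply/measurable_fun_pair; [exact: measurable_tnth|exact: measurable_behead].
Qed.

Definition mpowerS : set (n.+1.-tuple T) -> \bar R :=
  pushforward (mu \x m)%E tuple_consp.

Let mpowerS0 : mpowerS set0 = 0%E.
Proof. by rewrite /mpowerS /pushforward preimage_set0 measure0. Qed.

Let mpowerS_ge0 A : (0 <= mpowerS A)%E.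
Proof. by rewrite /mpowerS /pushforward measure_ge0. Qed.

Let mpowerS_sigma_additive : semi_sigma_additive mpowerS.
Proof.
move=> F mF tF mUF; rewrite /mpowerS /pushforward preimage_bigcup.
apply: measure_semi_sigma_additive.
- by move=> i; rewrite -[X in measurable X]setTI; exact: measurable_tuple_consp.
- apply/trivIsetP => /= i j _ _ ij; rewrite -preimage_setI.
  by move/trivIsetP : tF => /(_ _ _ _ _ ij) ->//; rewrite preimage_set0.
- by rewrite -preimage_bigcup -[X in measurable X]setTI; exact: measurable_tuple_consp.
Qed.

HB.instance Definition _ := isMeasure.Build _ _ _ mpowerS
  mpowerS0 mpowerS_ge0 mpowerS_sigma_additive.

Let mpowerS_sigma_finite : sigma_finite setT mpowerS.
Proof.
have /sigma_finiteP[F [UF ndF Foo]] := sigma_finiteT mu.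
have /sigma_finiteP[G [UG ndG Goo]] := sigma_finiteT m.
exists (fun i => tuple_unconsp @^-1` (F i `*` G i)).
  apply/esym; rewrite -subTset => v _ /=.
  have [k _ Fk] : (\bigcup_i F i) (thead v) by rewrite -UF.
  have [l _ Gl] : (\bigcup_i G i) [tuple of behead v] by rewrite -UG.
  exists (maxn k l) => //; split => /=.
    by move: Fk; exact/subsetPset/ndF/leq_maxl.
  by move: Gl; exact/subsetPset/ndG/leq_maxr.
move=> i; have [mF Fi] := Foo i; have [mG Gi] := Goo i.
have mFG : measurable (F i `*` G i) by exact: measurableX.
split.
  by rewrite -[X in measurable X]setTI; exact: measurable_tuple_unconsp.
rewrite /mpowerS /pushforward -comp_preimage.
rewrite (_ : _ \o _ = id) ?preimage_id.
  by rewrite product_measure1E// lte_mul_pinfty// ge0_fin_numE.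
by apply/funext => xv; exact: tuple_conspK.
Qed.

HB.instance Definition _ := Measure_isSigmaFinite.Build _ _ _ mpowerS
  mpowerS_sigma_finite.

End step.

Fixpoint mpower n : {sigma_finite_measure set (n.-tuple T) -> \bar R} :=
  match n with
  | 0%N => dirac ([tuple] : 0.-tuple T)
  | n'.+1 => mpowerS (mpower n')
  end.

Lemma mpower_box n (A : 'I_n -> set T) :
  (forall i, measurable (A i)) ->
  mpower n [set v | forall i, A i (tnth v i)] =
  (\prod_(i < n) mu (A i))%E.
Proof.
elim: n => [|n IHn] in A * => mA.
  by rewrite big_ord0 /= diracE mem_set// => -[].
rewrite big_ord_recl -IHn// -product_measure1E//; last first.
  rewrite (_ : [set _ | _] = \bigcap_(i : 'I_n) ((@tnth _ T ^~ i) @^-1` A (lift ord0 i))).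
    apply: fin_bigcap_measurable => [|i _]; first exact: finite_finset.
    by rewrite -[X in measurable X]setTI; exact: measurable_tnth.
  by apply/seteqP; split => [v + i _|v + i]; exact.
rewrite /= /mpowerS /pushforward; congr product_measure1.
apply/seteqP; split => [[x v] /= Av|[x v] /= [Ax Av] i].
  split => [|i]; first exact: (Av ord0).
  by have := Av (lift ord0 i); rewrite tnthS.
case: (unliftP ord0 i) => [j|] ->; first by rewrite tnthS.
exact: Ax.
Qed.

End measure_power.

(* Euler's Gamma function, meaningful for 0 < z *)
Definition gamma {R : realType} (z : R) : R :=
  \int[lebesgue_measure]_(t in `]0, +oo[) (t `^ (z - 1) * expR (- t)).

Definition gg_pdf {R : realType} (p : nat) (b m t : R) : R :=
  p%:R * expR (- (`|t - m| / b) ^+ p) / (2 * b * gamma (p%:R^-1)).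

Definition gg_mass {R : realType} (p : nat) (b c0 c1 m : R) : R :=
  \int[lebesgue_measure]_(t in `[c0, c1]) gg_pdf p b m t.

Section truncated_generalized_gaussian.
Context {R : realType} {r : nat}.

Definition box (c0 c1 : 'I_r -> R) : set (r.-tuple R) :=
  [set y | forall k, c0 k <= tnth y k <= c1 k].

(* [\_] extends the density by 0 outside of the box. *)
Definition tgg_pdf (p : nat) (b : R) (c0 c1 m : 'I_r -> R) : r.-tuple R -> R :=
  (fun y => \prod_(k < r)
     (p%:R * expR (- (`|tnth y k - m k| / b) ^+ p) /
      (2 * b * gamma (p%:R^-1) * gg_mass p b (c0 k) (c1 k) (m k))))
  \_ (box c0 c1).

End truncated_generalized_gaussian.

Definition has_density d (T : measurableType d) (R : realType)
    (mu : {measure set T -> \bar R}) (P : probability T R) (f : T -> R) : Prop :=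
  forall Q, measurable Q -> P Q = (\int[mu]_(y in Q) (f y)%:E)%E.

(* The sup of the empty set is 0: without neighboring data sets, the
   sensitivities are 0. *)
Section sensitivity.
Context {R : realType} {X : Type} (neighbor : X -> X -> Prop).

Definition sensitivity1 (f : X -> R) : R :=
  sup [set z | exists x x', neighbor x x' /\ z = `|f x - f x'|].

Definition sensitivity (r p : nat) (s : 'I_r -> X -> R) : R :=
  sup [set z | exists x x', neighbor x x' /\
    z = (\sum_(k < r) `|s k x - s k x'| ^+ p) `^ p%:R^-1].

End sensitivity.

(* [M x] is the law of the output on the data set x. The ratio and the
   logarithm are those of the extended reals: if exactly one of the two
   probabilities is zero, the left-hand side is +oo and the bound fails. *)
Definition differentially_private d (T : measurableType d) (R : realType)
    (X : Type) (neighbor : X -> X -> Prop) (eps : R)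
    (M : X -> probability T R) : Prop :=
  forall x x', neighbor x x' -> forall Q : set T, measurable Q ->
    (0 < M x Q \/ 0 < M x' Q)%E ->
    (`| lne (M x Q / M x' Q) | <= eps%:E)%E.

(* Main.v *)
Require Import Defs.
From HB Require Import structures.
From mathcomp Require Import all_boot all_order all_algebra.
From mathcomp Require Import all_classical all_reals all_analysis.
From mathcomp Require Import measurable_realfun ring lra.
Import Order.TTheory GRing.Theory Num.Theory.
Import numFieldNormedType.Exports.
Local Open Scope classical_set_scope.
Local Open Scope ring_scope.

(* Moving the location of a coordinate by [d] changes [|t - m| ^+ p] by at most
   [(a + d) ^+ p - a ^+ p], where [a] is the length of the interval: the
   increment of [u |-> u ^+ p] over a step [d] is nondecreasing in [u], and
   [|t - m| <= a]. This costs one factor [expR (cost / b ^+ p)] in the kernel,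
   and a second one in the normalizing mass, whence the 2 in the bound on [b].
   The binomial formula turns the increment into the sum over [j] of the
   statement: the terms [j < p] are bounded coordinatewise by the l_1
   sensitivities, and the terms [j = p] add up to at most the p-th power of the
   l_p sensitivity. The pointwise ratio bound on the densities is integrated
   over the event, in both directions. *)

(** * Increments of the p-th power *)

Lemma exprDB_sum {R : comNzRingType} (a d : R) [p : nat] : (1 <= p)%N ->
  (a + d) ^+ p - a ^+ p =
  \sum_(1 <= j < p) 'C(p, j)%:R * a ^+ (p - j) * d ^+ j + d ^+ p.
Proof.
move=> p1.
(* The term [j = 0] is [a ^+ p] and cancels; the term [j = p] is set apart. These two terms are
   distinct because [1 <= p]. *)
rewrite exprDn -(big_mkord xpredT (fun i => a ^+ (p - i) * d ^+ i *+ 'C(p, i))).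
rewrite big_nat_recr//= big_ltn// subn0 subnn bin0 binn !expr0 mulr1 mul1r !mulr1n.
rewrite -[X in X - _]addrA [LHS]addrC addKr; congr (_ + _).
by apply: eq_bigr => j _; rewrite -mulrA mulr_natl.
Qed.

(** In the binomial expansion of the increment, every term is a nonnegative multiple of a power of
    [u]. *)
Lemma ler_exprDB {R : realDomainType} (p : nat) [u a d : R] :
  0 <= u -> u <= a -> 0 <= d ->
  (u + d) ^+ p - u ^+ p <= (a + d) ^+ p - a ^+ p.
Proof.
move=> u0 ua d0; have a0 := le_trans u0 ua.
case: p => [|p]; first by rewrite !expr0 subrr.
rewrite !exprDB_sum// lerD2r ler_sum// => j _.
by rewrite ler_wpM2r ?exprn_ge0// ler_wpM2l// lerXn2r.
Qed.

(** * Ratio bounds for the truncated densities *)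

Section privacy_loss.
Context {R : realType}.

(* At most [shift_cost p a d / b ^+ p] is added to the exponent of the kernel
   when its location moves by [d] inside an interval of length [a]. *)
Definition shift_cost (p : nat) (a d : R) : R := (a + d) ^+ p - a ^+ p.

(** By the triangle inequality [|t - m'|] is at most [|t - m| + |m - m'|]; then [ler_exprDB]
    replaces [|t - m|] by the length of the interval. *)
Lemma gg_kernel_le (p : nat) (b c0 c1 m m' t : R) : 0 < b ->
  c0 <= m <= c1 -> c0 <= t <= c1 ->
  expR (- (`|t - m| / b) ^+ p) <=
  expR (shift_cost p `|c1 - c0| `|m - m'| / b ^+ p)
    * expR (- (`|t - m'| / b) ^+ p).
Proof.
move=> b0 mc tc; rewrite -expRD ler_expR !expr_div_n lerBrDr addrC -mulNr -mulrDl.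
rewrite ler_pM2r ?invr_gt0 ?exprn_gt0//.
have h : `|t - m'| ^+ p <= (`|t - m| + `|m - m'|) ^+ p.
  by rewrite lerXn2r// ?nnegrE ?addr_ge0//; exact: ler_distD.
have : `|t - m| <= `|c1 - c0|.
  rewrite [leRHS]ger0_norm; first by rewrite ler_norml; lra.
  by lra.
move=> /(ler_exprDB p (normr_ge0 (t - m))) /(_ (normr_ge0 (m - m'))).
by apply: le_trans; rewrite lerD2r.
Qed.

Lemma gg_pdf_integrable (p : nat) (b c0 c1 m : R) :
  lebesgue_measure.-integrable `[c0, c1] (EFin \o gg_pdf p b m).
Proof.
apply: continuous_compact_integrable; first exact: segment_compact.
apply: continuous_subspaceT => t; rewrite /gg_pdf.
apply: cvgM; last exact: cvg_cst.
apply: cvgM; first exact: cvg_cst.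
apply: continuous_cvg; first exact: continuous_expR.
apply: cvgN.
apply: (@continuous_cvg _ _ _ _ _ (fun t => `|t - m| / b) (fun x => x ^+ p)).
  exact: exprn_continuous.
apply: cvgM; last exact: cvg_cst.
apply: cvg_norm; apply: cvgB; [exact: cvg_id|exact: cvg_cst].
Qed.

Lemma gamma_ge0 (z : R) : 0 <= gamma z.
Proof.
by apply: Rintegral_ge0 => t _; rewrite mulr_ge0 ?powR_ge0 ?expR_ge0.
Qed.

Lemma gg_mass_ge0 (p : nat) [b : R] (c0 c1 m : R) : 0 < b -> 0 <= gg_mass p b c0 c1 m.
Proof.
move=> b0; apply: Rintegral_ge0 => t _.
by rewrite divr_ge0 ?mulr_ge0 ?gamma_ge0 ?expR_ge0// ltW.
Qed.

Lemma gg_mass_le (p : nat) (b c0 c1 m m' : R) : 0 < b -> c0 <= m <= c1 ->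
  gg_mass p b c0 c1 m <=
  expR (shift_cost p `|c1 - c0| `|m - m'| / b ^+ p) * gg_mass p b c0 c1 m'.
Proof.
move=> b0 mc; rewrite /gg_mass -RintegralZl//; last exact: gg_pdf_integrable.
apply: le_Rintegral => //; first exact: gg_pdf_integrable.
  rewrite (_ : _ \o _ = fun t => ((expR (shift_cost p `|c1 - c0| `|m - m'| / b ^+ p))%:E
     * (EFin \o gg_pdf p b m') t)%E)//.
  by apply: integrableZl => //; exact: gg_pdf_integrable.
move=> t /=; rewrite in_itv/= => tc.
rewrite /gg_pdf mulrA ler_wpM2r//.
  by rewrite invr_ge0 !mulr_ge0 ?gamma_ge0 ?ltW.
by rewrite mulrCA ler_wpM2l//; exact: gg_kernel_le.
Qed.

Lemma tgg_factor_le (p : nat) (b c0 c1 m m' t : R) : 0 < b ->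
  c0 <= m <= c1 -> c0 <= m' <= c1 -> c0 <= t <= c1 ->
  p%:R * expR (- (`|t - m| / b) ^+ p) /
    (2 * b * gamma (p%:R^-1) * gg_mass p b c0 c1 m) <=
  expR (2 * (shift_cost p `|c1 - c0| `|m - m'| / b ^+ p)) *
  (p%:R * expR (- (`|t - m'| / b) ^+ p) /
    (2 * b * gamma (p%:R^-1) * gg_mass p b c0 c1 m')).
Proof.
move=> b0 mc m'c tc.
(* The masses are compared both ways: one bound carries positivity from [A] to [A'], the other is
   inverted to bound [A^-1]. *)
have := @gg_mass_le p b c0 c1 m m' b0 mc.
have := @gg_mass_le p b c0 c1 m' m b0 m'c.
have := @gg_kernel_le p b c0 c1 m m' t b0 mc tc.
rewrite (distrC m'); set h := shift_cost _ _ _ / _.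
have := gg_mass_ge0 p c0 c1 m b0; have := gg_mass_ge0 p c0 c1 m' b0.
move: (gg_mass _ _ _ _ m) (gg_mass _ _ _ _ m') => A A' A'0 A0 hk A'A AA'.
(* When [c0 = c1] the mass [A] vanishes, and [A^-1 = 0]. *)
have [A0'|A1] := eqVneq A 0.
  by rewrite A0' mulr0 invr0 mulr0 !mulr_ge0 ?invr_ge0 ?mulr_ge0 ?gamma_ge0 ?expR_ge0// ltW.
have Ap : 0 < A by rewrite lt0r A1.
have A'p : 0 < A' by rewrite -(pmulr_rgt0 _ (expR_gt0 h)); exact: lt_le_trans AA'.
have AV : A^-1 <= expR h * A'^-1.
  by rewrite ler_pdivlMr// mulrC ler_pdivrMr.
(* This factor is common to both sides, so that only the kernels and the inverse masses remain to be
   compared. *)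
have G0 : 0 <= p%:R * (2 * b * gamma p%:R^-1)^-1 :> R.
  by rewrite mulr_ge0// invr_ge0 !mulr_ge0 ?gamma_ge0 ?ltW.
rewrite !(invfM _ A) !(invfM _ A') mulr_natl expRM_natl expr2.
move: G0; set G := (_ * gamma _)^-1; set e1 := expR (- _); set e2 := expR (- _) => G0.
rewrite [leLHS](_ : _ = (p%:R * G) * (e1 * A^-1)); last by ring.
rewrite [leRHS](_ : _ = (p%:R * G) * ((expR h * e2) * (expR h * A'^-1))); last by ring.
apply: ler_wpM2l => //; apply: ler_pM => //; first exact: expR_ge0.
by rewrite invr_ge0.
Qed.

Lemma measurable_box (r : nat) (c0 c1 : 'I_r -> R) :
  measurable (box c0 c1 : set (r.-tuple (measurableTypeR R))).
Proof.
rewrite (_ : box c0 c1 =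
    \bigcap_(k : 'I_r) ((fun y => tnth y k) @^-1` `[c0 k, c1 k])).
  apply: fin_bigcap_measurable => [|k _]; first exact: finite_finset.
  rewrite -[X in measurable X]setTI.
  by apply: measurable_tnth => //; exact: measurable_itv.
by apply/seteqP; split => [y yB k _|y yB k] /=;
  [rewrite in_itv/=; exact: yB|have := yB k Logic.I; rewrite /= in_itv].
Qed.

Lemma measurable_tgg_pdf (r p : nat) (b : R) (c0 c1 m : 'I_r -> R) :
  measurable_fun setT
    (tgg_pdf p b c0 c1 m : r.-tuple (measurableTypeR R) -> measurableTypeR R).
Proof.
rewrite /tgg_pdf; apply: (iffLR (measurable_restrictT _ _)).
  exact: measurable_box.
apply: measurable_funTS; apply: measurable_prod => k _.
apply: measurable_funM; last exact: measurable_cst.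
apply: measurable_funM; first exact: measurable_cst.
apply: measurableT_comp; first exact: measurable_expR.
apply: measurable_funN; apply: measurable_funX.
apply: measurable_funM; last exact: measurable_cst.
apply: measurableT_comp; first exact: normr_measurable.
apply: measurable_funB; last exact: measurable_cst.
exact: measurable_tnth.
Qed.

Lemma tgg_pdf_ge0 (r p : nat) (b : R) (c0 c1 m : 'I_r -> R) y : 0 < b ->
  0 <= tgg_pdf p b c0 c1 m y.
Proof.
move=> b0; rewrite /tgg_pdf patchE; case: ifP => // _.
apply: prodr_ge0 => k _.
by rewrite divr_ge0 ?mulr_ge0 ?gamma_ge0 ?gg_mass_ge0 ?expR_ge0// ltW.
Qed.

(** Both densities vanish outside the same box, which does not depend on the data; inside it the
    coordinatewise bounds are multiplied. *)
Lemma tgg_pdf_le (r p : nat) (b : R) (c0 c1 m m' : 'I_r -> R) y : 0 < b ->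
  (forall k, c0 k <= m k <= c1 k) -> (forall k, c0 k <= m' k <= c1 k) ->
  tgg_pdf p b c0 c1 m y <=
  expR (2 * (\sum_(k < r) shift_cost p `|c1 k - c0 k| `|m k - m' k| / b ^+ p))
  * tgg_pdf p b c0 c1 m' y.
Proof.
move=> b0 mc m'c; rewrite /tgg_pdf !patchE.
case: ifPn => [/set_mem yB|_]; last by rewrite mulr0.
rewrite mulr_sumr expR_sum -big_split/=; apply: ler_prod => k _.
rewrite tgg_factor_le// andbT.
by rewrite divr_ge0 ?mulr_ge0 ?gamma_ge0 ?gg_mass_ge0 ?expR_ge0// ltW.
Qed.

End privacy_loss.

(** * From pointwise density ratios to privacy *)

Lemma differentially_private_density d (T : measurableType d) (R : realType)
    (mu : {measure set T -> \bar R}) (X : Type) (neighbor : X -> X -> Prop)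
    (eps : R) (M : X -> probability T R) (f : X -> T -> R) :
  (forall x x', neighbor x x' -> neighbor x' x) ->
  (forall x, has_density mu (M x) (f x)) ->
  (forall x, measurable_fun setT (f x)) -> (forall x y, 0 <= f x y) ->
  (forall x x', neighbor x x' -> forall y, f x y <= expR eps * f x' y) ->
  differentially_private neighbor eps M.
Proof.
move=> nC Mf mf f0 fle.
have Mle x x' Q : neighbor x x' -> measurable Q ->
    fine (M x Q) <= expR eps * fine (M x' Q).
  move=> xx' mQ; rewrite -lee_fin EFinM !fineK ?fin_num_measure// !Mf//.
  rewrite -ge0_integralZl//.
  - apply: ge0_le_integral => //.
    + by move=> y _; rewrite lee_fin.
    + by apply/measurable_EFinP; exact: measurable_funTS.
    + by apply: measurable_funeM; apply/measurable_EFinP; exact: measurable_funTS.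
    + by move=> y _; rewrite -EFinM lee_fin fle.
  - by apply/measurable_EFinP; exact: measurable_funTS.
  - by move=> y _; rewrite lee_fin.
move=> x x' xx' Q mQ.
have := Mle _ _ _ xx' mQ; have := Mle _ _ _ (nC _ _ xx') mQ.
have fin z : M z Q = (fine (M z Q))%:E by rewrite fineK ?fin_num_measure.
rewrite (fin x) (fin x') /= !lte_fin.
move: (fine (M x Q)) (fine (M x' Q)) => u v vu uv uv0.
(* Each probability bounds the other up to a factor, so one being positive makes both positive and
   the logarithm finite. *)
have [u0 v0] : 0 < u /\ 0 < v.
  case: uv0 => [u0|v0]; split => //.
    by rewrite -(pmulr_rgt0 _ (expR_gt0 eps)); exact: lt_le_trans uv.
  by rewrite -(pmulr_rgt0 _ (expR_gt0 eps)); exact: lt_le_trans vu.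
rewrite inver gt_eqF// -EFinM lne_EFin ?divr_gt0// ln_div// /= lee_fin ler_norml.
have le_ln a c : 0 < a -> 0 < c -> a <= expR eps * c -> ln a <= eps + ln c.
  move=> a0 c0 ac; rewrite -[X in X + _]expRK -lnM ?posrE ?expR_gt0//.
  by rewrite ler_ln ?posrE ?mulr_gt0 ?expR_gt0.
by have := le_ln _ _ u0 v0 uv; have := le_ln _ _ v0 u0 vu; lra.
Qed.

(** * Bounding the cost by the sensitivities *)

Lemma powR_invnK {R : realType} [p : nat] [x : R] : (1 <= p)%N -> 0 <= x ->
  (x `^ p%:R^-1) ^+ p = x.
Proof.
move=> p1 x0; rewrite -powR_mulrn ?powR_ge0// -powRrM mulVf ?powRr1//.
by rewrite pnatr_eq0 -lt0n.
Qed.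

Section sensitivity_bounds.
Context {R : realType} {X : Type} (neighbor : X -> X -> Prop).

(** Boundedness of [f] makes the [sup] a genuine upper bound rather than the default value 0. *)
Lemma le_sensitivity1 (f : X -> R) (a0 a1 : R) x x' :
  (forall x, a0 <= f x <= a1) -> neighbor x x' ->
  `|f x - f x'| <= sensitivity1 neighbor f.
Proof.
move=> fa xx'; apply: ub_le_sup; last by exists x, x'.
exists (a1 - a0) => _ [y [y' [_ ->]]]; rewrite ler_norml.
by have := fa y; have := fa y'; lra.
Qed.

Lemma le_sensitivity (r p : nat) (s : 'I_r -> X -> R) (a0 a1 : 'I_r -> R) x x' :
  (1 <= p)%N -> (forall k x, a0 k <= s k x <= a1 k) -> neighbor x x' ->
  \sum_(k < r) `|s k x - s k x'| ^+ p <= sensitivity neighbor p s ^+ p.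
Proof.
move=> p1 sa xx'.
have sum0 y y' : 0 <= \sum_(k < r) `|s k y - s k y'| ^+ p.
  by apply: sumr_ge0 => k _; rewrite exprn_ge0.
rewrite -[leLHS](powR_invnK p1)//.
have le_sens : (\sum_(k < r) `|s k x - s k x'| ^+ p) `^ p%:R^-1 <=
    sensitivity neighbor p s.
  apply: ub_le_sup; last by exists x, x'.
  (* The l_p norm of the side lengths of the box bounds every l_p distance between two answers. *)
  exists ((\sum_(k < r) (a1 k - a0 k) ^+ p) `^ p%:R^-1) => _ [y [y' [_ ->]]].
  have le_sum : \sum_(k < r) `|s k y - s k y'| ^+ p <=
      \sum_(k < r) (a1 k - a0 k) ^+ p.
    apply: ler_sum => k _; have := sa k y; have := sa k y' => sy' sy.
    by rewrite lerXn2r ?nnegrE ?ler_norml//; lra.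
  by rewrite ge0_ler_powR ?nnegrE ?invr_ge0// (le_trans _ le_sum).
by rewrite lerXn2r ?nnegrE ?powR_ge0// (le_trans _ le_sens) ?powR_ge0.
Qed.

Lemma sum_shift_cost_le (r p : nat) (s : 'I_r -> X -> R) (a0 a1 : 'I_r -> R)
    x x' :
  (1 <= p)%N -> (forall k x, a0 k <= s k x <= a1 k) -> neighbor x x' ->
  \sum_(k < r) shift_cost p `|a1 k - a0 k| `|s k x - s k x'| <=
  \sum_(k < r) \sum_(1 <= j < p)
    'C(p, j)%:R * `|a1 k - a0 k| ^+ (p - j) * sensitivity1 neighbor (s k) ^+ j
  + sensitivity neighbor p s ^+ p.
Proof.
move=> p1 sa xx'; under eq_bigr do rewrite /shift_cost exprDB_sum//.
rewrite big_split/=; apply: lerD; last exact: le_sensitivity sa xx'.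
apply: ler_sum => k _; apply: ler_sum => j _.
have le_sens := le_sensitivity1 (s k) (a0 k) (a1 k) x x' (sa k) xx'.
rewrite ler_wpM2l ?mulr_ge0 ?exprn_ge0// lerXn2r ?nnegrE//.
exact: le_trans le_sens.
Qed.

End sensitivity_bounds.

Theorem mainTheorem4 (R : realType) (X : Type) (neighbor : X -> X -> Prop)
    (neighborC : forall x x', neighbor x x' -> neighbor x' x)
    (eps : R) (eps_gt0 : 0 < eps) (p : nat) (p_ge1 : (1 <= p)%N)
    (r : nat) (s : 'I_r -> X -> R) (c0 c1 : 'I_r -> R)
    (s_bounded : forall k x, c0 k <= s k x <= c1 k)
    (b : R) (b_gt0 : 0 < b)
    (M : X -> probability (r.-tuple (measurableTypeR R)) R)
    (M_tgg : forall x, has_density (mpower lebesgue_measure r) (M x)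
       (tgg_pdf p b c0 c1 (fun k => s k x))) :
  b >= (2 * eps^-1 *
         (\sum_(k < r) \sum_(1 <= j < p)
             'C(p, j)%:R * `|c1 k - c0 k| ^+ (p - j)
               * sensitivity1 neighbor (s k) ^+ j
          + sensitivity neighbor p s ^+ p)) `^ p%:R^-1 ->
  differentially_private neighbor eps M.
Proof.
move=> b_ge; apply: differentially_private_density neighborC M_tgg _ _ _.
- by move=> x; exact: measurable_tgg_pdf.
- by move=> x y; exact: tgg_pdf_ge0.
move=> x x' xx' y; apply: (le_trans (tgg_pdf_le _ _ _ _ _ _ (fun k => s k x') _ b_gt0 _ _)).
- by move=> k; exact: s_bounded.
- by move=> k; exact: s_bounded.
rewrite ler_wpM2r ?tgg_pdf_ge0// ler_expR -mulr_suml.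
have := sum_shift_cost_le neighbor r p s c0 c1 x x' p_ge1 s_bounded xx'.
move: b_ge; set S := (_ + _); set cost := \sum_(k < r) _ => b_ge cost_le.
(* Since [S] dominates [cost], it is nonnegative too, which lets the p-th power undo the p-th root
   in the hypothesis on [b]. *)
have cost_ge0 : 0 <= cost.
  by apply: sumr_ge0 => k _;
    rewrite /shift_cost subr_ge0 lerXn2r ?nnegrE ?addr_ge0 ?lerDl.
have S_le : 2 * eps^-1 * S <= b ^+ p.
  have S_ge0 : 0 <= 2 * eps^-1 * S.
    apply: mulr_ge0; last exact: le_trans cost_le.
    by rewrite mulr_ge0// invr_ge0 ltW.
  rewrite -[leLHS](powR_invnK p_ge1)//.
  by rewrite lerXn2r ?nnegrE ?powR_ge0// ltW.
(* With the denominator cleared, the chain is [2 * cost <= 2 * S <= eps * b ^+ p]. *)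
rewrite mulrA ler_pdivrMr ?exprn_gt0// (le_trans _ (ler_wpM2l (ltW eps_gt0) S_le))//.
rewrite mulrA [eps * _]mulrCA divff ?gt_eqF// mulr1.
by rewrite ler_wpM2l.
Qed.
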